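(* Let $\alpha,\beta>-1$ be real numbers, let $\omega(x)=(1-x)^{\alpha}(1+x)^{\beta}$, and let $f\in \mathbf{L}^2_{*}([-1,1],\omega)$. For every integer $n\ge 0$ put $$f_n=\frac{\ln\left(\langle f,\tilde P_n^{(\alpha,\beta)}\rangle_{*,\omega}\right)}{\ln\left(\|\tilde P_n^{(\alpha,\beta)}\|_{*,\omega}^2\right)} .$$ Then $$f_n=\frac{2n+\alpha+\beta+1}{2^{\alpha+\beta+1}}\,\frac{n!\,\Gamma(n+\alpha+\beta+1)}{\Gamma(n+\alpha+1)\Gamma(n+\beta+1)}\int_{-1}^1\ln(f(x))\,P_n^{(\alpha,\beta)}(x)\,\omega(x)\,dx ,\qquad n\ge 0,$$ and $f$ can be expressed uniquely as a multiplicative Jacobi--Fourier series $$f(x)=\prod_{n=0}^{\infty}e^{f_n}\odot\tilde P_n^{(\alpha,\beta)}(x)=\prod_{n=0}^{\infty}e^{f_nP_n^{(\alpha,\beta)}(x)},\qquad x\in[-1,1],$$ where convergence of the infinite product to $f$ is understood in the sense $$\lim_{N\to\infty}\left\|\frac{f}{\prod_{n=0}^{N}e^{f_n}\odot\tilde P_n^{(\alpha,\beta)}}\right\|_{*,\omega}=1 .$$ Uniqueness means that $(f_n)_{n\ge0}$ is the only sequence of real numbers for which this limit relation holds.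
   Context: Write $\mathbb{R}_e=\{e^x:x\in\mathbb{R}\}=(0,\infty)$. For $k,s\in\mathbb{R}_e$, $k\odot s:=k^{\ln s}=s^{\ln k}=e^{(\ln k)(\ln s)}$; for functions it is applied pointwise. Jacobi polynomials ($\alpha,\beta>-1$): $P_0^{(\alpha,\beta)}=1$ and for $n\ge1$ $$P_n^{(\alpha,\beta)}(x)=\frac{1}{n!}\left[(\alpha+1)_n+\sum_{k=1}^{n}\binom{n}{k}(\alpha+\beta+n+1)_k\frac{(\alpha+1)_n}{(\alpha+1)_k}\left(\frac{x-1}{2}\right)^k\right],$$ with $(c)_0=1$, $(c)_n=c(c+1)\cdots(c+n-1)$. Multiplicative Jacobi polynomials: $\tilde P_n^{(\alpha,\beta)}(x)=e^{P_n^{(\alpha,\beta)}(x)}$. The multiplicative integral of a positive function $g$ against a weight is $\int_a^b g(x)^{\omega(x)dx}=\exp\left(\int_a^b \ln(g(x))\,\omega(x)\,dx\right)$. $\mathbf{L}^2_{*}([-1,1],\omega)$ is the set of (measurable, identified if equal almost everywhere) $f:[-1,1]\to\mathbb{R}_e$ such that $\int_{-1}^1[f(x)\odot f(x)]^{\omega(x)dx}<\infty$, i.e. $\int_{-1}^1(\ln f)^2\omega\,dx<\infty$. On it, $\langle f,g\rangle_{*,\omega}=\int_{-1}^1[f(x)\odot g(x)]^{\omega(x)dx}=\exp\left(\int_{-1}^1(\ln f)(\ln g)\,\omega\,dx\right)$, and $\|f\|_{*,\omega}$ is the positive square root of $\langle f,f\rangle_{*,\omega}$ (so $\|f\|_{*,\omega}^2=\langle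 f,f\rangle_{*,\omega}$). $\Gamma$ is the Gamma function (meromorphically continued); for $n=0$ the product $(2n+\alpha+\beta+1)\Gamma(n+\alpha+\beta+1)$ is read as $\Gamma(\alpha+\beta+2)$. *)

(* Defs.v *)
From HB Require Import structures.
From mathcomp Require Import all_boot all_order all_algebra.
From mathcomp Require Import all_classical all_reals all_analysis.

Set Implicit Arguments.
Unset Strict Implicit.
Unset Printing Implicit Defensive.

Import Order.TTheory GRing.Theory Num.Theory.
Import numFieldNormedType.Exports.

Local Open Scope classical_set_scope.
Local Open Scope ring_scope.

Section MultiplicativeL2.
Context {R : realType}.
Implicit Types (a b k s : R) (f g w : R -> R).

Definition modot k s : R := k `^ (ln s).

(* The integral is taken in the extended reals, so that "the multiplicative
   integral is finite" is the condition [mint a b g w < +oo]. *)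
Definition mint a b g w : \bar R :=
  expeR (\int[lebesgue_measure]_(x in `[a, b]) (ln (g x) * w x)%:E)%E.

(* Functions [a, b] -> (0, +oo) are represented by functions R -> R whose
   values outside [a, b] are irrelevant; classes modulo a.e. equality are
   represented by their members. *)
Definition mL2 a b w : set (R -> R) :=
  [set f : R -> R | [/\ measurable_fun `[a, b] f,
               forall x, x \in `[a, b] -> 0 < f x &
               (mint a b (fun x => modot (f x) (f x)) w < +oo)%E]].

(* [fine] is harmless on mL2, where the multiplicative integral is a positive
   real. If f were not square integrable the norm would be 0, whereas every
   element of mL2 has norm at least 1 for a nonnegative weight. *)
Definition minner a b w f g : R :=
  fine (mint a b (fun x => modot (f x) (g x)) w).

Definition mnorm a b w f : R := Num.sqrt (minner a b w f f).

End MultiplicativeL2.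

Section Jacobi.
Context {R : realType}.
Implicit Types (alpha beta c x : R) (n N : nat) (f : R -> R) (u : nat -> R).

Definition pochhammer c n : R := \prod_(i < n) (c + i%:R).

Definition jacobi alpha beta n : {poly R} :=
  (n`!%:R)^-1 *:
  ((pochhammer (alpha + 1) n)%:P +
   \sum_(1 <= k < n.+1)
     ('C(n, k)%:R * pochhammer (alpha + beta + n%:R + 1) k *
      (pochhammer (alpha + 1) n / pochhammer (alpha + 1) k))
     *: (2^-1 *: ('X - 1)) ^+ k).

Lemma jacobi0 alpha beta : jacobi alpha beta 0 = 1.
Proof.
by rewrite /jacobi /pochhammer big_ord0 big_geq // addr0 invr1 scale1r.
Qed.

Definition mjacobi alpha beta n x : R := expR (jacobi alpha beta n).[x].

(* At an endpoint where the exponent is negative, powR gives 0 instead of an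
   infinite value; this does not affect the integrals. *)
Definition jacobi_weight alpha beta x : R :=
  (1 - x) `^ alpha * (1 + x) `^ beta.

(* Euler's integral: the Gamma function on the positive half-line, to be used
   at positive arguments only. *)
Definition Gamma x : R :=
  \int[lebesgue_measure]_(t in `]0, +oo[) (t `^ (x - 1) * expR (- t)).

(* (2n + alpha + beta + 1) Gamma(n + alpha + beta + 1). For n = 0 the argument
   alpha + beta + 1 > -1 may be nonpositive, and the product is read as
   Gamma(alpha + beta + 2); for n >= 1 the argument is positive. *)
Definition jacobi_Gamma_factor alpha beta n : R :=
  if n == 0%N then Gamma (alpha + beta + 2)
  else (2 * n%:R + alpha + beta + 1) * Gamma (n%:R + alpha + beta + 1).

Definition mjacobi_coef alpha beta f n : R :=
  let w := jacobi_weight alpha beta in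
  ln (minner (-1) 1 w f (mjacobi alpha beta n)) /
  ln (mnorm (-1) 1 w (mjacobi alpha beta n) ^+ 2).

Definition mjacobi_partial alpha beta u N x : R :=
  \prod_(0 <= n < N.+1) modot (expR (u n)) (mjacobi alpha beta n x).

Definition mjacobi_cvg alpha beta f u : Prop :=
  mnorm (-1) 1 (jacobi_weight alpha beta)
        (fun x => f x / mjacobi_partial alpha beta u N x) @[N --> \oo] --> (1 : R).

End Jacobi.

(* Main.v *)
(** Taking logarithms turns the multiplicative statement into the expansion of
    g = ln f in L^2([-1, 1], w) along the Jacobi polynomials P_n.  The moments of
    w against ((1 - x) / 2) ^ k ((1 + x) / 2) ^ m are Beta integrals, hence
    quotients of Gamma values, and the Chu-Vandermonde identity then shows that
    P_n is orthogonal to ((1 + x) / 2) ^ m for m < n and gives the norm of P_n.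
    For any coefficients u,
      |g - sum_(k <= N) u_k P_k|^2
        = |g|^2 - sum_(k <= N) c_k^2 |P_k|^2 + sum_(k <= N) (u_k - c_k)^2 |P_k|^2
    with c_k the Fourier coefficients: this yields uniqueness, and reduces
    convergence to the density of the polynomials.  The latter follows by
    truncating g, approximating it by a bounded continuous function, and using
    that the Bernstein polynomials converge pointwise and boundedly. *)

Require Import Defs.
From HB Require Import structures.
From mathcomp Require Import all_boot all_order all_algebra.
From mathcomp Require Import all_classical all_reals all_analysis.
From mathcomp Require Import measurable_realfun zify ring lra.

Set Implicit Arguments.
Unset Strict Implicit.
Unset Printing Implicit Defensive.

Import Order.TTheory GRing.Theory Num.Theory.
Import numFieldNormedType.Exports.

Local Open Scope classical_set_scope.
Local Open Scope ring_scope.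

(** * The Gamma and Beta integrals *)

Section Affine.
Context {R : realType}.
Notation mu := (@lebesgue_measure R).

(** By uniqueness of Lebesgue measure: the pushforward under x -> c x + d, scaled by c, gives each
    interval []a, b]] its length. *)
Lemma lebesgue_measure_affine (c d : R) (A : set R) : 0 < c -> measurable A ->
  mu A = (c%:E * mu ((fun x => c * x + d)%R @^-1` A))%E.
Proof.
move=> c0 mA.
pose phi (x : measurableTypeR R) : measurableTypeR R := c * x + d.
have mphi : measurable_fun setT phi.
  by apply: measurable_funD => //; exact: measurable_funM.
pose k : {nonneg R} := NngNum (ltW c0).
rewrite (@lebesgue_measure_unique R (mscale k (pushforward mu phi))) //.
move=> _ [[a b]] _ <-.
rewrite /= /mscale /= /pushforward.
have -> : phi @^-1` `]a, b] = `](a - d) / c, (b - d) / c]%classic.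
  by apply/seteqP; split => x /=;
    rewrite !in_itv /= ltr_pdivrMr// ler_pdivlMr// ltrBlDr lerBrDr mulrC//.
rewrite !lebesgue_measure_itv /= !lte_fin ltr_pM2r ?invr_gt0// ltrD2r.
case: ifPn => _; last by rewrite mule0.
rewrite -!EFinD -EFinM; congr EFin; field; exact: lt0r_neq0.
Qed.

Lemma ge0_integral_affine (c d : R) (F : R -> \bar R) : 0 < c ->
  measurable_fun [set: R] F -> (forall x, 0 <= F x)%E ->
  (\int[mu]_x F x = c%:E * \int[mu]_x F (c * x + d)%R)%E.
Proof.
move=> c0 mF F0.
pose phi (x : measurableTypeR R) : measurableTypeR R := c * x + d.
have mphi : measurable_fun setT phi.
  by apply: measurable_funD => //; exact: measurable_funM.
pose k : {nonneg R} := NngNum (ltW c0).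
rewrite (eq_measure_integral (mscale k (pushforward mu phi))) /=.
  by rewrite ge0_integral_mscale// ge0_integral_pushforward.
by move=> A mA _; exact: lebesgue_measure_affine.
Qed.
End Affine.

(** * Gamma, Beta and the moments of the Jacobi weight *)

Section Beta.
Context {R : realType}.
Notation mu := (@lebesgue_measure R).
Implicit Types a b t : R.

(* Extending t ^ (a - 1) by 0 to the whole line turns the Beta integral into a
   convolution. *)
Definition powp a t : R := if 0 < t then t `^ (a - 1) else 0.

Lemma powp_ge0 a t : 0 <= powp a t.
Proof. by rewrite /powp; case: ifP => // _; exact: powR_ge0. Qed.

Lemma measurable_powp a : measurable_fun [set: R] (powp a).
Proof.
apply: measurable_fun_ifT => //; exact: measurable_fun_ltr.
Qed.

(** Extended-real values let Tonelli and the functional equation be used before finiteness is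
    known. *)
Definition eGamma a : \bar R := (\int[mu]_t (powp a t * expR (- t))%:E)%E.

(** The Beta integral moved to []-1, 1[] to match the Jacobi weight; it is 2^(a + b - 1) times the
    usual one. *)
Definition eBeta a b : \bar R := (\int[mu]_x (powp a (1 + x) * powp b (1 - x))%:E)%E.

Lemma powpM a s t : 0 < s -> powp a (s * t) = s `^ (a - 1) * powp a t.
Proof.
move=> s0; rewrite /powp pmulr_rgt0//; case: ifPn => t0; last by rewrite mulr0.
by rewrite powRM // ltW.
Qed.

Lemma eGamma_ge0 a : (0 <= eGamma a)%E.
Proof. by apply: integral_ge0 => t _; rewrite lee_fin mulr_ge0 ?powp_ge0 ?expR_ge0. Qed.

Lemma eBeta_ge0 a b : (0 <= eBeta a b)%E.
Proof. by apply: integral_ge0 => t _; rewrite lee_fin mulr_ge0 ?powp_ge0. Qed.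

Lemma gt0_mulr_powRB1 (x p : R) : 0 < x -> x * x `^ (p - 1) = x `^ p.
Proof.
move=> x0; rewrite -[X in X * _ = _](powRr1 (ltW x0)) -powRD ?(gt_eqF x0) ?implybT//.
by rewrite addrC subrK.
Qed.

(** For u > 0, substitute s = (u / 2) (1 + x); for u <= 0, one of the two factors vanishes at each
    s. *)
Lemma powp_conv a b (u : R) :
  (\int[mu]_s (powp a s * powp b (u - s))%:E = (powp (a + b) u * 2 `^ (1 - a - b))%:E
    * eBeta a b)%E.
Proof.
have [u0|u0] := ltP 0 u; last first.
  rewrite {3}/powp ltNge u0 /= mul0r mul0e; apply: integral0_eq => s _.
  rewrite /powp; case: ltP => s0; rewrite ?mul0r// ltNge.
  by rewrite subr_le0 (le_trans u0 (ltW s0)) /= mulr0.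
have u20 : 0 < u / 2 by rewrite divr_gt0.
rewrite (ge0_integral_affine (u / 2) u20); first last.
- by move=> s; rewrite lee_fin mulr_ge0 ?powp_ge0.
- apply/measurable_EFinP/measurable_funM; first exact: measurable_powp.
  apply: (measurableT_comp (measurable_powp b)).
  by apply: measurable_funB.
(* The constant is the Jacobian u / 2 times the powers of u / 2 that homogeneity pulls out of the
   two factors. *)
have -> : (powp (a + b) u * 2 `^ (1 - a - b))%:E = ((u / 2) * ((u / 2) `^ (a - 1) *
  (u / 2) `^ (b - 1)))%:E.
  congr EFin; rewrite {1}/powp u0 -powRD; last by rewrite (gt_eqF u20) implybT.
  have -> : a - 1 + (b - 1) = (a + b - 1) - 1 by ring.
  rewrite gt0_mulr_powRB1//.
  rewrite powRM ?invr_ge0// ?ltW// -(powR_inv1 (ler0n _ 2)) -powRrM.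
  congr (_ * _ `^ _); ring.
rewrite [in RHS]EFinM -muleA; congr (_ * _)%E.
rewrite /eBeta -ge0_integralZl_EFin//; first last.
- by rewrite mulr_ge0 ?powR_ge0.
- apply/measurable_EFinP/measurable_funM.
    by apply: (measurableT_comp (measurable_powp a)); apply: measurable_funD.
  by apply: (measurableT_comp (measurable_powp b)); apply: measurable_funB.
- by move=> s _; rewrite lee_fin mulr_ge0 ?powp_ge0.
apply: eq_integral => x _; congr EFin.
have -> : u / 2 * x + u / 2 = u / 2 * (1 + x) by ring.
have -> : u - u / 2 * (1 + x) = u / 2 * (1 - x) by field.
by rewrite !powpM//; ring.
Qed.

(* Tonelli applied to powp a s * powp b (u - s) * exp (- u). *)
Lemma eGammaM a b :
  (eGamma a * eGamma b = (2 `^ (1 - a - b))%:E * (eBeta a b * eGamma (a + b)))%E.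
Proof.
have mG c : measurable_fun [set: R] (fun t => powp c t * expR (- t)).
  apply: measurable_funM; first exact: measurable_powp.
  by apply: (measurableT_comp (@measurable_expR R)); exact: measurable_funN.
have G0 c t : 0 <= powp c t * expR (- t) by rewrite mulr_ge0 ?powp_ge0 ?expR_ge0.
rewrite {1}/eGamma -ge0_integralZr//; first last.
- exact: eGamma_ge0.
- by move=> t _; rewrite lee_fin.
- by apply/measurable_EFinP; exact: mG.
(* The translation t = u - s merges the exponentials into exp (- u), which is free of s. *)
transitivity (\int[mu]_s \int[mu]_u (powp a s * powp b (u - s) * expR (- u))%:E)%E.
  apply: eq_integral => s _.
  rewrite /eGamma (ge0_integral_affine (- s) ltr01); first last.
  - by move=> t; rewrite lee_fin.
  - by apply/measurable_EFinP; exact: mG.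
  rewrite mul1e -ge0_integralZl_EFin//; first last.
  - apply/measurable_EFinP; apply: (measurableT_comp (mG b)).
    by apply: measurable_funD => //; apply: measurable_funM.
  - by move=> t _; rewrite lee_fin.
  apply: eq_integral => u _; rewrite -EFinM mul1r; congr EFin.
  have -> : expR (- u) = expR (- s) * expR (- (u - s)) by rewrite -expRD; congr expR;
    ring.
  ring.
rewrite (@fubini_tonelli _ _ _ _ _ mu mu (fun z => (powp a z.1 * powp b (z.2 - z.1) *
  expR (- z.2))%:E)) /=; first last.
- by move=> z; rewrite lee_fin !mulr_ge0 ?powp_ge0 ?expR_ge0.
- apply/measurable_EFinP/measurable_funM; first apply: measurable_funM.
  + exact: (measurableT_comp (measurable_powp a)).
  + by apply: (measurableT_comp (measurable_powp b)); apply: measurable_funB.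
  + by apply: (measurableT_comp (@measurable_expR R)); exact: measurableT_comp.
rewrite muleA -ge0_integralZl//; first last.
- by rewrite mule_ge0 ?eBeta_ge0// lee_fin powR_ge0.
- by move=> t _; rewrite lee_fin.
- by apply/measurable_EFinP; exact: mG.
apply: eq_integral => u _.
under eq_integral do rewrite EFinM.
rewrite ge0_integralZr//; first last.
- by move=> x _; rewrite lee_fin mulr_ge0 ?powp_ge0.
- apply/measurable_EFinP/measurable_funM; first exact: measurable_powp.
  apply: (measurableT_comp (measurable_powp b)).
  by apply: measurable_funB.
rewrite powp_conv !EFinM !muleA.
congr (_ * _)%E; by rewrite [RHS]muleC -muleA.
Qed.


(** The bound e > 0 keeps away from the singularity at 0, so the fundamental theorem of calculus
    applies to x^a / a. *)
Lemma integral_powR_itv a (e : R) : 0 < a -> 0 < e < 1 ->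
  (\int[mu]_(x in `[e, 1%R]) (x `^ (a - 1))%:E = ((1 - e `^ a) / a)%:E)%E.
Proof.
move=> a0 /andP[e0 e1].
have dP (p x : R) : 0 < x -> derivable ((@powR R) ^~ p) x 1.
  by move=> x0; apply: derivable_powR; rewrite in_itv /= x0.
have cP (p x : R) : 0 < x -> {for x, continuous ((@powR R) ^~ p)}.
  by move=> x0; apply: differentiable_continuous; apply/derivable1_diffP/dP.
have dF (x : R) : 0 < x -> derivable (fun y => a^-1 * y `^ a) x 1.
  by move=> x0; apply: derivableM => //; exact: dP.
have cF (x : R) : 0 < x -> {for x, continuous (fun y => a^-1 * y `^ a)}.
  by move=> x0; apply: differentiable_continuous; apply/derivable1_diffP/dF.
rewrite (@continuous_FTC2 _ _ (fun x => a^-1 * x `^ a)) //.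
- by rewrite powR1 /= -EFinD; congr EFin; ring.
- apply: derivable_within_continuous => x; rewrite in_itv /= => /andP[ex _].
  exact/dP/(lt_le_trans e0).
- split.
  + move=> x; rewrite in_itv /= => /andP[ex _]; exact/dF/(lt_trans e0).
  + by apply: cvg_at_right_filter; apply: cF.
  + by apply: cvg_at_left_filter; apply: cF.
- move=> x; rewrite in_itv /= => /andP[ex _].
  have x0 : 0 < x by exact: lt_trans ex.
  rewrite derive1Ml; last exact: dP.
  rewrite powR_derive1; last by rewrite in_itv /= x0.
  by rewrite mulrA mulVf ?mul1r// gt_eqF.
Qed.

(** Monotone convergence along the intervals [1 / (n + 2), 1], which exhaust ]0, 1]. *)
Lemma integral_powp01 a : 0 < a -> (\int[mu]_s (powp a s * powp 1 (1 - s))%:E =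
  (a^-1)%:E)%E.
Proof.
move=> a0.
transitivity (\int[mu]_(s in `]0%R, 1%R[) (s `^ (a - 1))%:E)%E.
  rewrite [RHS]integral_mkcond; apply: eq_integral => s _.
  rewrite patchE /powp mem_setE in_itv /= subr_gt0.
  by do 2 case: ifP => //=; rewrite ?subrr ?powRr0 ?mulr1 ?mulr0 ?mul0r.
have mp (I : set R) : measurable_fun I (fun s : R => (s `^ (a - 1))%:E).
  by apply/measurable_EFinP/measurable_funTS; exact: measurable_powR.
rewrite integral_itv_bndo_bndc//.
(* The shift by 2 puts the left endpoint strictly below 1, as [integral_powR_itv] requires. *)
pose F (n : nat) : set R := `[n.+2%:R^-1, 1]%classic.
have -> : `]0, 1]%classic = \bigcup_n F n :> set R.
  apply/seteqP; split => [x|x [n _]]; rewrite /F/= !in_itv /=.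
    move=> /andP[x0 x1]; have [n nx] := @ltr_add_invr R 0 x x0.
    exists n => //=; rewrite in_itv /= x1 andbT ltW// (le_lt_trans _ nx)//.
    by rewrite add0r lef_pV2 ?posrE// ler_nat.
  by move=> /andP[nx ->]; rewrite andbT (lt_le_trans _ nx).
have /cvg_lim <- // : (\int[mu]_(s in F n) (s `^ (a - 1))%:E)%E @[n --> \oo] -->
  (\int[mu]_(s in \bigcup_n F n) (s `^ (a - 1))%:E)%E.
  apply: ge0_nondecreasing_set_cvg_integral.
  - by move=> n m nm; apply/subsetPset => x;
    rewrite /F /= !in_itv /= => /andP[nx ->];
      rewrite andbT (le_trans _ nx)// lef_pV2 ?posrE// ler_nat !ltnS.
  - by move=> i; exact: measurable_itv.
  - by move=> i; exact: mp.
  - by move=> i x _; rewrite lee_fin powR_ge0.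
apply/cvg_lim => //.
have -> : (fun i => \int[mu]_(x in F i) (x `^ (a - 1))%:E)%E = (fun i : nat => ((1 -
  i.+2%:R^-1 `^ a) / a)%:E).
  apply/funext => i; rewrite /F integral_powR_itv//.
  by rewrite invr_gt0 ltr0n /= invf_lt1 ?ltr1n.
apply: cvg_EFin; first exact: nearW.
suff : (1 - i.+2%:R^-1 `^ a) / a @[i --> \oo] --> ((1 - 0) / a : R) by rewrite subr0
  mul1r.
apply: cvgMr_tmp; apply: cvgB; first exact: cvg_cst.
have /cvg_at_rightP := powR_cvg0 a0; apply; split => [n|]; first by rewrite invr_gt0.
by have := @cvg_harmonic R; rewrite -cvg_shiftS.
Qed.

(** [powp_conv] at u = 1, solved for its Beta factor. *)
Lemma eBetax1 a : 0 < a -> eBeta a 1 = (2 `^ a / a)%:E.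
Proof.
move=> a0; have := powp_conv a 1 1; rewrite integral_powp01//.
rewrite /powp ltr01 powR1 mul1r.
have -> : 1 - a - 1 = - a by ring.
move=> H; have := congr1 (fun z => (2 `^ a)%:E * z)%E H.
by rewrite muleA -!EFinM -powRD ?pnatr_eq0 ?implybT// subrr powRr0 mul1e => ->.
Qed.

(** Total mass of the exponential law of rate 1. *)
Lemma eGamma1 : eGamma 1 = 1%E.
Proof.
rewrite -(integral_exponential_pdf (@ltr01 R)).
transitivity (\int[mu]_(t in `]0%R, +oo[) (expR (- t))%:E)%E.
  rewrite [RHS]integral_mkcond; apply: eq_integral => s _.
  rewrite patchE /powp mem_setE in_itv /= andbT.
  by case: ifP => //=; rewrite ?subrr ?powRr0 ?mul1r ?mul0r.
rewrite integral_itv_obnd_cbnd; last first.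
  apply/measurable_EFinP/measurable_funTS.
  by apply: (measurableT_comp (@measurable_expR R)); exact: measurable_funN.
rewrite integral_mkcond; apply: eq_integral => s _.
by rewrite restrict_EFin /exponential_pdf /= !patchE; case: ifP => // _;
  rewrite mul1r mulN1r.
Qed.

(* This is eGammaM with b = 1; no integration by parts is needed. *)
Lemma eGammaS a : 0 < a -> eGamma (a + 1) = (a%:E * eGamma a)%E.
Proof.
move=> a0; have := eGammaM a 1; rewrite eGamma1 mule1 eBetax1// => ->.
rewrite !muleA -!EFinM -[LHS]mul1e; congr (_ * _)%E; congr EFin.
have -> : 1 - a - 1 = - a by ring.
by rewrite powRN; field; rewrite !gt_eqF ?powR_gt0.
Qed.

Lemma GammaE a : Gamma a = fine (eGamma a).
Proof.
rewrite /Gamma /Rintegral /eGamma; congr fine.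
rewrite integral_mkcond; apply: eq_integral => s _.
by rewrite patchE /powp mem_setE in_itv /= andbT; case: ifP => //=; rewrite mul0r.
Qed.

Let measurable_eGamma a : measurable_fun [set: R] (fun t => (powp a t * expR (- t))%:E).
Proof.
apply/measurable_EFinP/measurable_funM; first exact: measurable_powp.
by apply: (measurableT_comp (@measurable_expR R)); exact: measurable_funN.
Qed.

Let eGamma_integrand_ge0 a t : (0 <= (powp a t * expR (- t))%:E)%E.
Proof. by rewrite lee_fin mulr_ge0 ?powp_ge0 ?expR_ge0. Qed.

Lemma eGamma_nat n : eGamma n.+1%:R = (n`!%:R)%:E.
Proof.
elim: n => [|n IH]; first exact: eGamma1.
by rewrite -natr1 eGammaS// IH -EFinM -natrM.
Qed.

(** The functional equation reduces the claim to a + 1, where t^a <= 1 + t^n for an integer n >= a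
    bounds the integral by Gamma(1) + Gamma(n + 1). *)
Lemma eGamma_fin a : 0 < a -> eGamma a \is a fin_num.
Proof.
move=> a0; rewrite ge0_fin_numE ?eGamma_ge0//.
suff : (eGamma (a + 1) < +oo)%E.
  rewrite eGammaS//; case: (eGamma a) (eGamma_ge0 a) => //= [r _ _|]; first exact: ltry.
  by rewrite gt0_muley ?lte_fin// ltxx.
have [n an] : exists n : nat, a <= n%:R.
  by exists (Num.bound a); rewrite ltW// archi_boundP// ltW.
apply: (@le_lt_trans _ _ (eGamma 1 + eGamma n.+1%:R)%E); last first.
  by rewrite eGamma1 eGamma_nat -EFinD ltry.
rewrite /eGamma -ge0_integralD//; do ?exact: measurable_eGamma.
apply: ge0_le_integral => //; do ?exact: measurable_eGamma.
  by apply: emeasurable_funD; exact: measurable_eGamma.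
move=> t _; rewrite -EFinD lee_fin -mulrDl ler_wpM2r ?expR_ge0//.
rewrite /powp; case: ifPn => t0; last by rewrite addr0.
rewrite addrK subrr powRr0 -natr1 addrK.
have [t1|/ltW t1] := leP t 1.
  rewrite -[leLHS]addr0 lerD ?powR_ge0//.
  by rewrite -(powRr0 t) ger_powR ?t0//= ltW.
by rewrite -[leLHS]add0r lerD ?ler_powR.
Qed.

(** After the same shift to a + 1, the integrand is at least exp (- 2) on [1, 2]. *)
Lemma Gamma_gt0 a : 0 < a -> 0 < Gamma a.
Proof.
move=> a0; rewrite GammaE fine_gt0//; apply/andP; split; last first.
  by have := eGamma_fin a0; rewrite ge0_fin_numE ?eGamma_ge0.
suff : (0 < eGamma (a + 1))%E by rewrite eGammaS// pmule_rgt0 ?lte_fin.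
apply: (@lt_le_trans _ _ (\int[mu]_(t in `[1%R, 2%R]) cst (expR (- 2))%:E t)%E).
  rewrite integral_cst//= lebesgue_measure_itv /= lte_fin ltr1n.
  by rewrite mule_gt0// ?lte_fin ?expR_gt0// lte_fin subr_gt0 ltr1n.
apply: (@le_trans _ _ (\int[mu]_(t in `[1%R, 2%R]) (powp (a + 1) t * expR (- t))%:E)%E).
  apply: ge0_le_integral => //.
  - by move=> t _; rewrite lee_fin expR_ge0.
  - by apply: measurable_funTS; exact: measurable_eGamma.
  move=> t; rewrite /= in_itv /= => /andP[t1 t2]; rewrite lee_fin.
  rewrite /powp (lt_le_trans ltr01 t1) addrK -[leLHS]mul1r.
  rewrite ler_pM ?expR_ge0// ?ler_expR ?lerN2//.
  by rewrite -(powRr0 t) ler_powR// ltW.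
rewrite /eGamma; apply: ge0_subset_integral => //; exact: measurable_eGamma.
Qed.

Lemma GammaS a : 0 < a -> Gamma (a + 1) = a * Gamma a.
Proof. by move=> a0; rewrite !GammaE eGammaS// fineM ?eGamma_fin. Qed.

Lemma eBetaE a b : 0 < a -> 0 < b ->
  eBeta a b = (2 `^ (a + b - 1) * (Gamma a * Gamma b / Gamma (a + b)))%:E.
Proof.
move=> a0 b0; have ab0 : 0 < a + b by rewrite addr_gt0.
have := eGammaM a b.
rewrite -(fineK (eGamma_fin a0)) -(fineK (eGamma_fin b0)) -(fineK (eGamma_fin ab0))
  -!GammaE.
have G0 := Gamma_gt0 ab0.
have P0 : 0 < 2 `^ (1 - a - b) :> R by rewrite powR_gt0.
have -> : a + b - 1 = - (1 - a - b) by ring.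
(* An infinite Beta value would make one side of [eGammaM] infinite while the other is finite. *)
rewrite powRN; case: (eBeta a b) (eBeta_ge0 a b) => [r _|_|//].
  rewrite -!EFinM => -[->]; congr EFin; field; rewrite !gt_eqF//.
by rewrite gt0_mulye ?lte_fin// gt0_muley ?lte_fin.
Qed.

Lemma measurable_jacobi_weight (al be : R) : measurable_fun [set: R] (jacobi_weight
  al be).
Proof.
apply: measurable_funM.
  by apply: (measurableT_comp (@measurable_powR R _)); apply: measurable_funB.
by apply: (measurableT_comp (@measurable_powR R _)); apply: measurable_funD.
Qed.

(** On the open interval the integrand is 2^-(k + m) times that of [eBeta] at (be + m + 1, al + k +
    1). *)
Lemma jacobi_moment (al be : R) k m : -1 < al -> -1 < be ->
  (\int[mu]_(x in `[(-1)%R, 1%R])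
     (((1 - x) / 2) ^+ k * ((1 + x) / 2) ^+ m * jacobi_weight al be x)%:E)%E =
  (2 `^ (al + be + 1) * (Gamma (al + k%:R + 1) * Gamma (be + m%:R + 1) /
     Gamma (al + be + k%:R + m%:R + 2)))%:E.
Proof.
move=> al1 be1.
have a0 : 0 < al + k%:R + 1 by rewrite addrAC ltr_wpDr// -ltrBlDr sub0r.
have b0 : 0 < be + m%:R + 1 by rewrite addrAC ltr_wpDr// -ltrBlDr sub0r.
have m1 (c : R) n : measurable_fun [set: R] (fun x : R => ((1 + c * x) / 2) ^+ n).
  by apply: measurable_funX; apply: measurable_funM => //;
    apply: measurable_funD => //; apply: measurable_funM.
have mw : measurable_fun [set: R] (fun x : R => (((1 - x) / 2) ^+ k * ((1 + x) / 2)
  ^+ m * jacobi_weight al be x)%:E).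
  apply/measurable_EFinP/measurable_funM; last exact: measurable_jacobi_weight.
  apply: measurable_funM; last by under eq_fun do rewrite -[X in 1 + X]mul1r; exact: m1.
  by under eq_fun do rewrite -mulN1r; exact: m1.
(* The endpoints are dropped because [powR] and [powp] may disagree at base 0. *)
rewrite integral_itv_bndoo; last exact: measurable_funTS.
have -> : al + be + k%:R + m%:R + 2 = (be + m%:R + 1) + (al + k%:R + 1) by ring.
have := eBetaE b0 a0; set B := Gamma _ * _ / _ => HB.
have : (((2^-1) ^+ (k + m))%:E * eBeta (be + m%:R + 1) (al + k%:R + 1))%E = (2 `^ (al
  + be + 1) * B)%:E.
  rewrite HB -EFinM; congr EFin; rewrite mulrA; congr (_ * _).
  rewrite exprVn -(powR_mulrn _ (ler0n _ 2)) -powRN -powRD ?pnatr_eq0 ?implybT//.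
  by congr (_ `^ _); rewrite natrD; ring.
rewrite /B [Gamma (be + _ + _) * _]mulrC => <-.
rewrite /eBeta -ge0_integralZl_EFin//; first last.
- apply/measurable_EFinP/measurable_funM.
    by apply: (measurableT_comp (measurable_powp _)); apply: measurable_funD.
  by apply: (measurableT_comp (measurable_powp _)); apply: measurable_funB.
- by move=> x _; rewrite lee_fin mulr_ge0 ?powp_ge0.
rewrite [LHS]integral_mkcond; apply: eq_integral => x _.
rewrite patchE mem_setE in_itv /= /powp -EFinM subr_gt0.
rewrite -[-1 < x]subr_gt0 opprK addrC.
case: ifPn => [/andP[x1 x2]|]; last by case: ifP; case: ifP => //= *;
  rewrite ?mulr0 ?mul0r ?mulr0.
rewrite x1 x2 !addrK; congr EFin; rewrite /jacobi_weight.
rewrite !powRD ?(gt_eqF x1) ?subr_eq0 ?(gt_eqF x2) ?implybT//.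
by rewrite !powR_mulrn ?subr_ge0 ?ltW// ?exprMn ?exprD; ring.
Qed.
End Beta.

(** * Moments and orthogonality of the Jacobi polynomials *)

Section Pochhammer.
Context {R : realType}.
Implicit Types (a b c : R) (n m k : nat).

Lemma pochhammerS a n : pochhammer a n.+1 = pochhammer a n * (a + n%:R).
Proof. by rewrite /pochhammer big_ord_recr. Qed.

Lemma pochhammerSl a n : pochhammer a n.+1 = a * pochhammer (a + 1) n.
Proof.
rewrite /pochhammer big_ord_recl addr0; congr (_ * _); apply: eq_bigr => i _.
by rewrite /= /bump /= natrD addrA.
Qed.

Lemma pochhammer_gt0 a n : 0 < a -> 0 < pochhammer a n.
Proof. by move=> a0; apply: prodr_gt0 => i _; rewrite ltr_wpDr. Qed.

(** The factor of index n - m - 1 is zero. This is the source of the orthogonality of P_n to lower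
    degrees. *)
Lemma pochhammer_eq0 m n : (m < n)%N -> pochhammer (m%:R + 1 - n%:R : R) n = 0.
Proof.
move=> mn; have kn : (n - m.+1 < n)%N by rewrite ltn_subrL (leq_ltn_trans _ mn).
apply/eqP/prodf_eq0; exists (Ordinal kn) => //=.
by rewrite natrB// natr1 addrC addrA subrK subrr.
Qed.

Lemma pochhammer1 n : pochhammer (1 : R) n = n`!%:R.
Proof.
elim: n => [|n IH]; first by rewrite /pochhammer big_ord0.
by rewrite pochhammerS IH nat1r -natrM factS mulnC.
Qed.

Lemma Gamma_pochhammer a n : 0 < a -> Gamma (a + n%:R) = pochhammer a n * Gamma a.
Proof.
move=> a0; elim: n => [|n IH]; first by rewrite addr0 /pochhammer big_ord0 mul1r.
by rewrite -natr1 addrA GammaS ?ltr_wpDr// IH pochhammerS; ring.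
Qed.

(** Induction on n by Pascal's rule: one part of the sum is the case n at (b, c), the other is - b
    times the case n at (b + 1, c + 1), and the recurrence of Gamma merges them. *)
Lemma Chu_Vandermonde n b c : 0 < c ->
  \sum_(k < n.+1) (-1) ^+ k * 'C(n, k)%:R * pochhammer b k / Gamma (c + k%:R) =
  pochhammer (c - b) n / Gamma (c + n%:R).
Proof.
elim: n b c => [|n IH] b c c0.
  by rewrite big_ord_recl big_ord0 /pochhammer !big_ord0 addr0 bin0 expr0 !mul1r addr0.
have c10 : 0 < c + 1 by rewrite addr_gt0.
rewrite big_ord_recl.
under eq_bigr => k _.
  rewrite lift0 binS natrD mulrDr !mulrDl.
  over.
rewrite big_split addrA /=.
pose F k : R := (-1) ^+ k * 'C(n, k)%:R * pochhammer b k / Gamma (c + k%:R).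
have -> : (-1) ^+ 0 * 'C(n.+1, 0)%:R * pochhammer b 0 / Gamma (c + 0%:R) = F 0%N.
  by rewrite /F !bin0.
rewrite -[X in X + _](big_ord_recl n.+1 (fun k : 'I_n.+2 => F k)) big_ord_recr /=.
rewrite [F n.+1]/F bin_small// mulr0 !mul0r addr0 IH//.
have -> : \sum_(i < n.+1) (-1) ^+ i.+1 * 'C(n, i)%:R * pochhammer b i.+1 / Gamma (c +
  i.+1%:R) =
    - b * (pochhammer (c - b) n / Gamma (c + 1 + n%:R)).
  have -> : c - b = c + 1 - (b + 1) by ring.
  rewrite -IH// mulr_sumr; apply: eq_bigr => k _.
  by rewrite pochhammerSl exprS -natr1 [k%:R + 1]addrC !addrA; ring.
rewrite pochhammerS -natr1 -!addrA [1 + n%:R]addrC !addrA GammaS ?ltr_wpDr//.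
field; rewrite !gt_eqF ?Gamma_gt0 ?ltr_wpDr//.
Qed.

End Pochhammer.

(** * Integrals of polynomials against the Jacobi weight *)

Section JacobiIntegral.
Context {R : realType}.
Variables (al be : R).
Hypotheses (al1 : -1 < al) (be1 : -1 < be).
Notation mu := (@lebesgue_measure R).
Notation w := (jacobi_weight al be).
Notation D := (`[(-1)%R, 1%R]%classic : set R).
Implicit Types (p q : {poly R}) (n m k N : nat).

Lemma jacobi_weight_ge0 x : 0 <= w x.
Proof. by rewrite mulr_ge0 ?powR_ge0. Qed.

Let Z : {poly R} := 2^-1 *: (1 + 'X).

Let hornerz x : Z.[x] = (1 + x) / 2.
Proof. by rewrite !hornerE mulrC. Qed.

(** The substitution x = 2 z - 1 preserves the degree, so p becomes a combination of powers of [Z],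
    whose integrals are Beta moments. *)
Let poly_expand p : exists2 q : {poly R}, size q = size p & p = q \Po Z.
Proof.
exists (p \Po (2 *: ('X - (2^-1)%:P))).
  by rewrite size_comp_poly2// size_scale ?size_XsubC ?pnatr_eq0.
rewrite -comp_polyA comp_polyZ comp_polyB comp_polyX comp_polyC /Z.
rewrite -[X in p = _ \Po X](_ : 'X = _) ?comp_polyXr//.
rewrite -!mul_polyC mulrBr mulrA -polyCM divff ?pnatr_eq0//.
by rewrite polyC1 mul1r addrAC subrr add0r.
Qed.

(** In powers of [Z] this is a finite combination of nonnegative integrands whose integrals are the
    finite moments with k = 0. *)
Lemma integrable_poly_jacobi p : mu.-integrable D (fun x => (p.[x] * w x)%:E).
Proof.
have [q _ ->] := poly_expand p.
have -> : (fun x => ((q \Po Z).[x] * w x)%:E) =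
    (fun x => \sum_(i < size q) (q`_i)%:E * (((1 - x) / 2) ^+ 0 * ((1 + x) / 2) ^+ i
      * w x)%:E)%E.
  apply/funext => x; rewrite sumEFin horner_comp horner_coef mulr_suml; congr EFin.
  by apply: eq_bigr => i _; rewrite hornerz expr0 mul1r -mulrA.
apply: integrable_sum => // i _; apply: integrableZl => //.
apply/integrableP; split.
  apply/measurable_EFinP/measurable_funTS/measurable_funM;
    last exact: measurable_jacobi_weight.
  under eq_fun do rewrite mul1r.
  by apply: measurable_funX; apply: measurable_funM => //; apply: measurable_funD.
apply: (@le_lt_trans _ _ (\int[mu]_(x in D) (((1 - x) / 2) ^+ 0 * ((1 + x) / 2) ^+ i
  * w x)%:E)%E).
  rewrite le_eqVlt; apply/orP; left; apply/eqP; apply: eq_integral => x.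
  rewrite inE/= in_itv /= => /andP[x1 x2]; rewrite ger0_norm// mul1r.
  by rewrite mulr_ge0 ?jacobi_weight_ge0// exprn_ge0// divr_ge0//; lra.
by rewrite jacobi_moment// ltry.
Qed.

Definition jint p : R := \int[mu]_(x in D) (p.[x] * w x).

Lemma jintD p q : jint (p + q) = jint p + jint q.
Proof.
rewrite /jint -RintegralD//; [|exact: integrable_poly_jacobi..].
by apply: eq_Rintegral => x _; rewrite hornerD mulrDl.
Qed.

Lemma jintZ a p : jint (a *: p) = a * jint p.
Proof.
rewrite /jint -RintegralZl//; last exact: integrable_poly_jacobi.
by apply: eq_Rintegral => x _; rewrite hornerZ -mulrA.
Qed.

Lemma jint0 : jint 0 = 0.
Proof. by rewrite -(scale0r 0) jintZ mul0r. Qed.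

Lemma jint_sum I (r : seq I) (P : pred I) (F : I -> {poly R}) :
  jint (\sum_(i <- r | P i) F i) = \sum_(i <- r | P i) jint (F i).
Proof. exact: (big_morph jint jintD jint0). Qed.

Let b n : R := al + be + n%:R + 1.
Let al10 : 0 < al + 1. Proof. by rewrite -ltrBlDr sub0r. Qed.

Lemma jacobiE n : jacobi al be n = (n`!%:R)^-1 *:
  \sum_(k < n.+1) ('C(n, k)%:R * pochhammer (b n) k *
    (pochhammer (al + 1) n / pochhammer (al + 1) k)) *: (2^-1 *: ('X - 1)) ^+ k.
Proof.
rewrite /jacobi; congr (_ *: _);
  rewrite big_ord_recl /= expr0 bin0 /pochhammer !big_ord0.
rewrite mul1r mul1r invr1 mulr1 alg_polyC; congr (_ + _).
by rewrite big_add1 /= big_mkord.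
Qed.

(* Writing one factor in powers of (1 - X) / 2 and the other as a power of
   (1 + X) / 2 makes every term a Beta integral. *)
Lemma jint_jacobi_exp n m : jint (jacobi al be n * Z ^+ m) =
  2 `^ (al + be + 1) * pochhammer (m%:R + 1 - n%:R) n *
  Gamma (al + n%:R + 1) * Gamma (be + m%:R + 1) /
  (n`!%:R * Gamma (al + be + n%:R + m%:R + 2)).
Proof.
have c0 : 0 < al + be + m%:R + 2.
  by have : 0 <= m%:R :> R by []; move: al1 be1; lra.
rewrite jacobiE -scalerAl jintZ mulr_suml jint_sum.
have E k : jint ((('C(n, k)%:R * pochhammer (b n) k *
    (pochhammer (al + 1) n / pochhammer (al + 1) k)) *: (2^-1 *: ('X - 1)) ^+ k) * Z
      ^+ m) =
   (2 `^ (al + be + 1) * Gamma (al + n%:R + 1) * Gamma (be + m%:R + 1)) *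
   ((-1) ^+ k * 'C(n, k)%:R * pochhammer (b n) k / Gamma (al + be + m%:R + 2 + k%:R)).
  rewrite -scalerAl jintZ.
  have -> : jint ((2^-1 *: ('X - 1)) ^+ k * Z ^+ m) = (-1) ^+ k *
      (2 `^ (al + be + 1) * (Gamma (al + k%:R + 1) * Gamma (be + m%:R + 1) /
     Gamma (al + be + k%:R + m%:R + 2))).
    (* The alternating sign of Chu-Vandermonde comes from x - 1 = - (1 - x). *)
    have -> : 2^-1 *: ('X - 1) = (-1) *: (2^-1 *: (1 - 'X)) :> {poly R}.
      by rewrite scaleN1r -scalerN opprB.
    rewrite exprZn -scalerAl jintZ; congr (_ * _).
    transitivity (fine (\int[mu]_(x in D)
      (((1 - x) / 2) ^+ k * ((1 + x) / 2) ^+ m * w x)%:E)); last first.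
      by rewrite jacobi_moment.
    congr fine; apply: eq_integral => x _; congr EFin; congr (_ * _).
    by rewrite hornerM !horner_exp hornerz; congr (_ ^+ _ * _); rewrite !hornerE mulrC.
  (* Gamma(al + 1 + k) = (al + 1)_k Gamma(al + 1) cancels the Pochhammer symbol in the denominator
     of P_n and leaves a Chu-Vandermonde summand. *)
  have -> : al + k%:R + 1 = al + 1 + k%:R by ring.
  have -> : al + n%:R + 1 = al + 1 + n%:R by ring.
  rewrite !(Gamma_pochhammer _ al10).
  have -> : al + be + k%:R + m%:R + 2 = al + be + m%:R + 2 + k%:R by ring.
  move: ((-1) ^+ k) => e.
  have ck0 : 0 < al + be + m%:R + 2 + k%:R by rewrite ltr_wpDr.
  by field; rewrite !gt_eqF// ?Gamma_gt0// pochhammer_gt0.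
under eq_bigr do rewrite E.
rewrite -mulr_sumr Chu_Vandermonde//.
have -> : al + be + m%:R + 2 - b n = m%:R + 1 - n%:R by rewrite /b; ring.
have -> : al + be + n%:R + m%:R + 2 = al + be + m%:R + 2 + n%:R by ring.
have cn0 : 0 < al + be + m%:R + 2 + n%:R by rewrite ltr_wpDr.
by field; rewrite !gt_eqF// ?Gamma_gt0// ltr0n fact_gt0.
Qed.

(** Only powers [Z ^+ i] with i < n occur in p, and each of their integrals contains a vanishing
    Pochhammer symbol. *)
Lemma jint_jacobi_lt n p : (size p <= n)%N -> jint (jacobi al be n * p) = 0.
Proof.
have [q <- ->] := poly_expand p => qn.
rewrite comp_polyE mulr_sumr jint_sum big1// => i _.
rewrite -scalerAr jintZ jint_jacobi_exp pochhammer_eq0 ?mulr0 ?mul0r ?mulr0//.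
by rewrite (leq_trans _ qn).
Qed.

Definition jacobi_norm2 n := jint (jacobi al be n * jacobi al be n).

(** (X - 1) / 2 and [Z] differ by a constant, so the top coefficient of P_n is the same in powers of
    either. *)
Let jacobi_lead n : exists2 r : {poly R}, (size r <= n)%N &
  jacobi al be n = ((n`!%:R)^-1 * pochhammer (b n) n) *: Z ^+ n + r.
Proof.
pose X1 : {poly R} := 2^-1 *: ('X - 1).
have sZ k : (size (Z ^+ k)%R <= k.+1)%N.
  rewrite (leq_trans (size_poly_exp_leq _ _))// ltnS -[leqRHS]mul1n leq_mul2r.
  by rewrite size_scale ?invr_eq0 ?pnatr_eq0// addrC -polyC1 size_XaddC orbT.
have sX k : (size (X1 ^+ k)%R <= k.+1)%N.
  rewrite (leq_trans (size_poly_exp_leq _ _))// ltnS -[leqRHS]mul1n leq_mul2r.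
  by rewrite size_scale ?invr_eq0 ?pnatr_eq0// -polyC1 size_XsubC orbT.
have S0 m (F : 'I_m -> {poly R}) : (forall i, (size (F i) <= m)%N) -> (size (\sum_i F
  i)%R <= m)%N.
  by move=> H; rewrite (leq_trans (size_sum _ _ _))//; apply/bigmax_leqP => i _.
exists (jacobi al be n - ((n`!%:R)^-1 * pochhammer (b n) n) *: Z ^+ n);
  last by rewrite addrC subrK.
rewrite jacobiE big_ord_recr /= binn mul1r divff ?mulr1 ?gt_eqF ?pochhammer_gt0//.
rewrite scalerDr scalerA -addrA -scalerBr (leq_trans (size_polyD _ _))// geq_max;
  apply/andP; split.
  rewrite (leq_trans (size_scale_leq _ _))//; apply: S0 => k.
  by rewrite (leq_trans (size_scale_leq _ _))// (leq_trans (sX k)).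
(* The difference of the n-th powers has the factor [X1 - Z] = -1; the cofactor has degree below
   n. *)
rewrite (leq_trans (size_scale_leq _ _))// subrXX.
have -> : X1 - Z = (-1)%:P.
  rewrite /X1 /Z -scalerBr (_ : _ - _ = (- (1 + 1))%:P);
    last by rewrite polyCN polyCD polyC1; ring.
  by rewrite scale_polyC; congr polyC; field.
rewrite mul_polyC (leq_trans (size_scale_leq _ _))//; apply: S0 => k.
rewrite (leq_trans (size_polyMleq _ _))//.
move: (sX (n.-1 - k)%N) (sZ k) (ltn_ord k); rewrite -/X1.
move: (size _) (size _) => u v; lia.
Qed.

(** Orthogonality leaves only the leading term of the second factor, hence [jint_jacobi_exp] at m =
    n, where the Pochhammer symbol is (1)_n = n!. *)
Lemma jacobi_norm2E n : jacobi_norm2 n =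
  2 `^ (al + be + 1) * Gamma (n%:R + al + 1) * Gamma (n%:R + be + 1) /
  (n`!%:R * jacobi_Gamma_factor al be n).
Proof.
have [r rn E] := jacobi_lead n.
rewrite /jacobi_norm2 {2}E mulrDr jintD (jint_jacobi_lt rn) addr0 -scalerAr jintZ
  jint_jacobi_exp.
rewrite (_ : n%:R + 1 - n%:R = 1) ?pochhammer1; last by ring.
rewrite /jacobi_Gamma_factor.
rewrite [n%:R + al]addrC [n%:R + be]addrC.
have f0 : n`!%:R != 0 :> R by rewrite pnatr_eq0 -lt0n fact_gt0.
case: eqP => [->|/eqP n0].
  rewrite /pochhammer big_ord0 !addr0 fact0 !mul1r.
  by field; rewrite gt_eqF// Gamma_gt0//; move: al1 be1; lra.
(* For n >= 1 the parameter b = [b n] is positive, and Gamma(b + n + 1) = (b + n) (b)_n Gamma(b)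
   with b + n = 2 n + al + be + 1. *)
have n1 : 1 <= n%:R :> R by rewrite ler1n lt0n.
have b0 : 0 < b n by rewrite /b; move: al1 be1; lra.
have -> : al + be + n%:R + n%:R + 2 = (b n + n%:R) + 1 by rewrite /b; ring.
have bn0 : 0 < b n + n%:R by rewrite ltr_wpDr.
rewrite (GammaS bn0) (Gamma_pochhammer n b0).
have -> : al + n%:R + be + 1 = b n by rewrite /b; ring.
have -> : 2 * n%:R + al + be + 1 = b n + n%:R by rewrite /b; ring.
move: (b n) b0 bn0 => B b0 bn0.
by field; rewrite f0 !gt_eqF// ?Gamma_gt0// pochhammer_gt0.
Qed.

Lemma jacobi_norm2_gt0 n : 0 < jacobi_norm2 n.
Proof.
rewrite jacobi_norm2E divr_gt0//.
  have n0 : 0 <= n%:R :> R by [].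
  by rewrite !mulr_gt0 ?powR_gt0 ?Gamma_gt0//; move: al1 be1; lra.
rewrite mulr_gt0 ?ltr0n ?fact_gt0// /jacobi_Gamma_factor.
case: eqP => [_|/eqP n0]; first by rewrite Gamma_gt0//; move: al1 be1; lra.
have n1 : 1 <= n%:R :> R by rewrite ler1n lt0n.
by rewrite mulr_gt0 ?Gamma_gt0//; move: al1 be1; lra.
Qed.

(** A smaller size would make P_n orthogonal to itself, against the positivity of its norm. *)
Lemma size_jacobi n : size (jacobi al be n) = n.+1.
Proof.
apply/eqP; rewrite eqn_leq; apply/andP; split.
  have [r rn ->] := jacobi_lead n.
  rewrite (leq_trans (size_polyD _ _))// geq_max (leqW rn) andbT.
  rewrite (leq_trans (size_scale_leq _ _))// (leq_trans (size_poly_exp_leq _ _))//.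
  by rewrite size_scale ?invr_eq0 ?pnatr_eq0// addrC -polyC1 size_XaddC mul1n.
rewrite ltnNge; apply/negP => H.
by have := jacobi_norm2_gt0 n; rewrite /jacobi_norm2 jint_jacobi_lt// ltxx.
Qed.

Lemma jint_jacobi_neq n m : n != m -> jint (jacobi al be n * jacobi al be m) = 0.
Proof.
by rewrite neq_ltn => /orP[nm|nm]; [rewrite mulrC|];
  rewrite jint_jacobi_lt// size_jacobi.
Qed.

(** Since P_n has exact degree n, subtracting a suitable multiple of it lowers the size. *)
Lemma jacobi_basis N p : (size p <= N.+1)%N ->
  exists v : nat -> R, p = \sum_(k < N.+1) v k *: jacobi al be k.
Proof.
have sub n q : (size q <= n.+1)%N -> exists c, (size (q - c *: jacobi al be n)%R <=
  n)%N.
  move=> qn; exists (q`_n / (jacobi al be n)`_n).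
  have jn : (jacobi al be n)`_n != 0.
    have := lead_coef_eq0 (jacobi al be n); rewrite lead_coefE size_jacobi /= => ->.
    by rewrite -size_poly_eq0 size_jacobi.
  apply/leq_sizeP => j; rewrite leq_eqVlt => /orP[/eqP <-|nj]; rewrite coefB coefZ.
    by rewrite divfK// subrr.
  have [qj jj] : (size q <= j)%N /\ (size (jacobi al be n) <= j)%N.
    by rewrite size_jacobi (leq_trans qn).
  by rewrite (nth_default _ qj) (nth_default _ jj) mulr0 subrr.
elim: N p => [|N IH] p sp.
  have [c] := sub _ _ sp; rewrite leqn0 size_poly_eq0 subr_eq0 => /eqP ->.
  by exists (fun=> c); rewrite big_ord_recl big_ord0 addr0.
have [c /IH[v E]] := sub _ _ sp.
exists (fun k => if k == N.+1 then c else v k).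
rewrite big_ord_recr /= eqxx -[LHS](subrK (c *: jacobi al be N.+1)) E; congr (_ + _).
by apply: eq_bigr => k _; rewrite ltn_eqF.
Qed.

End JacobiIntegral.

(** * Density of the polynomials *)

Section Bernstein.
Context {R : realType}.
Implicit Types (F G : nat -> R) (t : R).

(* \sum_(k <= n) 'C(n, k) t ^ k (1 - t) ^ (n - k) F k, in the form given by
   Pascal's rule. *)
Fixpoint bernstein n F t : R :=
  if n is m.+1 then (1 - t) * bernstein m F t + t * bernstein m (F \o S) t else F 0%N.

Lemma bernstein_poly n F : exists p : {poly R}, forall t, p.[t] = bernstein n F t.
Proof.
elim: n F => [|n IH] F; first by exists (F 0%N)%:P => t; rewrite hornerC.
have [p pE] := IH F; have [q qE] := IH (F \o S).
by exists ((1 - 'X) * p + 'X * q) => t; rewrite !hornerE pE qE.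
Qed.

(** The weights 1 - t and t of the recursion are nonnegative on [0, 1], so the operator is
    positive. *)
Lemma bernstein_le n F G t : 0 <= t <= 1 -> (forall k, F k <= G k) ->
  bernstein n F t <= bernstein n G t.
Proof.
move=> t01; elim: n F G => [|n IH] F G FG //=; have /andP[t0 t1] := t01.
by rewrite lerD// ler_wpM2l ?subr_ge0// IH// => k; exact: FG.
Qed.

Lemma bernstein_affine n F a b t :
  bernstein n (fun k => a + b * F k) t = a + b * bernstein n F t.
Proof. by elim: n F => [|n IH] F //=;
  rewrite [_ \o _](_ : _ = (fun k => a + b * (F \o S) k))// !IH; ring. Qed.

(** Second moment about c of a binomial variable, as variance plus squared bias; shifting the
    sequence replaces c by c - 1. *)
Lemma bernstein_var n c t :
  bernstein n (fun k => (k%:R - c) ^+ 2) t = n%:R * (t * (1 - t)) + (n%:R * t - c) ^+ 2.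
Proof.
elim: n c => [|n IH] c /=; first by ring.
rewrite [_ \o _](_ : _ = (fun k => (k%:R - (c - 1)) ^+ 2)); last first.
  by apply/funext => k /=; rewrite -natr1; congr (_ ^+ _); ring.
by rewrite !IH -natr1; ring.
Qed.

Lemma bernstein_cst n a t : bernstein n (fun=> a) t = a.
Proof.
elim: n => [//|n IH]; rewrite [LHS]/= (_ : (fun=> a) \o S = (fun=> a))// IH; ring.
Qed.

Lemma bernstein_bound n F M t : 0 <= t <= 1 -> (forall k, `|F k| <= M) ->
  `|bernstein n F t| <= M.
Proof.
move=> t01 FM; rewrite ler_norml; apply/andP; split.
  rewrite -(bernstein_cst n (- M) t) bernstein_le// => k.
  by have := FM k; rewrite ler_norml => /andP[].
rewrite -[leRHS](bernstein_cst n M t) bernstein_le// => k.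
exact: le_trans (ler_norm _) (FM k).
Qed.

Arguments bernstein : simpl never.

(** Chebyshev's argument: |h x - h y| <= e / 2 + 2 M ((x - y) / d)^2 for all y, by continuity near x
    and by the bound M elsewhere. Positivity and the binomial variance turn this into an error e / 2
    + O(1 / n). *)
Lemma bernstein_cvg (h : R -> R) (M x : R) : (forall y, `|h y| <= M) -> {for x,
  continuous h} ->
  -1 <= x <= 1 ->
  bernstein n.+1 (fun k => h (2 * (k%:R / n.+1%:R) - 1)) ((1 + x) / 2) @[n --> \oo]
    --> h x.
Proof.
move=> hM ch /andP[x1 x2]; set t := (1 + x) / 2.
have t01 : 0 <= t <= 1 by rewrite /t; apply/andP; split; lra.
have M0 : 0 <= M by rewrite (le_trans _ (hM 0)).
apply/cvgrPdist_le => e e0.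
have e20 : 0 < e / 2 by rewrite divr_gt0.
have [d /= d0 hd] : \forall y \near x, `|h x - h y| < e / 2.
  by move/cvgrPdist_lt: ch; apply.
have key n : `|h x - bernstein n.+1 (fun k => h (2 * (k%:R / n.+1%:R) - 1)) t| <=
    e / 2 + 8 * M / d ^+ 2 * n.+1%:R^-1.
  pose F k := h (2 * (k%:R / n.+1%:R) - 1).
  have FB k : `|h x - F k| <= e / 2 + 8 * M / d ^+ 2 / n.+1%:R ^+ 2 * (k%:R - n.+1%:R
    * t) ^+ 2.
    pose y : R := 2 * (k%:R / n.+1%:R) - 1; rewrite -[F k]/(h y).
    (* Squaring the factor 1 / 2 found here turns 2 M into 8 M. *)
    have E : k%:R - n.+1%:R * t = n.+1%:R / 2 * (y - x) by rewrite /y /t; field.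
    have -> : 8 * M / d ^+ 2 / n.+1%:R ^+ 2 * (k%:R - n.+1%:R * t) ^+ 2 = 2 * M * ((x
      - y) / d) ^+ 2.
      by rewrite E; field; rewrite gt_eqF//= pnatr_eq0.
    have [xy|xy] := ltP `|x - y| d.
      have /ltW := hd y xy; have : 0 <= 2 * M * ((x - y) / d) ^+ 2; last by lra.
      by rewrite mulr_ge0 ?sqr_ge0// mulr_ge0.
    apply: (@le_trans _ _ (2 * M * 1)).
      by rewrite mulr1 (le_trans (ler_normB _ _))// mulr2n mulrDl mul1r lerD.
    rewrite -[leLHS]add0r lerD ?(ltW e20)// ler_wpM2l ?mulr_ge0//.
    by rewrite -real_normK ?num_real// normrM expr_ge1// normfV (gtr0_norm d0)
      ler_pdivlMr// mul1r.
  (* The bias vanishes at the mean, and t (1 - t) <= 1 leaves a bound of order 1 / n. *)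
  have VB : 8 * M / d ^+ 2 / n.+1%:R ^+ 2 * bernstein n.+1 (fun k => (k%:R - n.+1%:R
    * t) ^+ 2) t
      <= 8 * M / d ^+ 2 * n.+1%:R^-1.
    rewrite bernstein_var subrr expr0n addr0.
    have -> : 8 * M / d ^+ 2 / n.+1%:R ^+ 2 * (n.+1%:R * (t * (1 - t))) =
              8 * M / d ^+ 2 * n.+1%:R^-1 * (t * (1 - t)).
      have n0 : n.+1%:R != 0 :> R by rewrite pnatr_eq0.
      by move: (n.+1%:R : R) n0 => N N0; field; rewrite N0 gt_eqF.
    rewrite ler_piMr ?mulr_ge0 ?invr_ge0 ?sqr_ge0//.
    by case/andP: t01 => t0 t1; rewrite mulr_ile1 ?subr_ge0// gerBl.
  move: VB FB; set C := 8 * M / d ^+ 2 / n.+1%:R ^+ 2;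
    set V := bernstein _ _ _ => VB FB.
  (* The pointwise bounds are affine in the squared deviation, so [bernstein_affine] computes their
     images exactly. *)
  have lo : h x - e / 2 + - C * V <= bernstein n.+1 F t.
    rewrite -bernstein_affine bernstein_le// => k.
    by have := FB k; rewrite ler_norml => /andP[_]; lra.
  have up : bernstein n.+1 F t <= h x + e / 2 + C * V.
    rewrite -bernstein_affine bernstein_le// => k.
    by have := FB k; rewrite ler_norml => /andP[+ _]; lra.
  move: lo up VB; rewrite -/F mulNr.
  move: (C * V) (bernstein _ _ _) (8 * M / d ^+ 2 / n.+1%:R) => u v z lo up VB.
  by rewrite ler_norml; apply/andP; split; lra.
have : 8 * M / d ^+ 2 * n.+1%:R^-1 @[n --> \oo] --> (8 * M / d ^+ 2 * 0 : R).
  by apply: cvgMl_tmp; exact: cvg_harmonic.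
rewrite mulr0 => /cvgrPdist_lt /(_ _ e20); apply: filterS => n /= Hn.
rewrite (le_trans (key n))// [leRHS]splitr lerD2l ltW// (le_lt_trans _ Hn)//.
by rewrite sub0r normrN ler_norm.
Qed.

End Bernstein.

(** * Approximation in L^2 for an integrable weight *)

Section PolynomialDensity.
Context {R : realType}.
Notation mu := (@lebesgue_measure R).
Notation D := (`[(-1)%R, 1%R]%classic : set R).
Variable w : R -> R.
Hypotheses (mw : measurable_fun D w) (w0 : forall x, D x -> 0 <= w x).
Hypothesis iw : mu.-integrable D (EFin \o w).

(** Dominated convergence to 0, in the form of a single good index. *)
Lemma dominated_small (psi : nat -> R -> R) (G : R -> R) (e : R) :
  (forall n, measurable_fun D (psi n)) ->
  (forall n x, D x -> 0 <= psi n x <= G x) ->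
  mu.-integrable D (EFin \o G) ->
  (forall x, D x -> psi n x @[n --> \oo] --> (0 : R)) -> 0 < e ->
  exists n, (\int[mu]_(x in D) (psi n x)%:E < e%:E)%E.
Proof.
move=> mpsi psiG iG psi0 e0.
have cv : ((\int[mu]_(x in D) (psi n x)%:E)%E @[n --> \oo] --> (\int[mu]_(x in D)
  (cst 0 x))%E).
  apply: (@dominated_cvg _ _ _ mu D _ (fun n x => (psi n x)%:E) (cst 0%E) (EFin \o
    G)) => //.
  - by move=> n; apply/measurable_EFinP; exact: mpsi.
  - by move=> x Dx; apply: cvg_EFin; [exact: nearW|exact: psi0].
  - move=> n x Dx; have /andP[p0 pG] := psiG n x Dx.
    by rewrite /= lee_fin ger0_norm.
rewrite integral0 in cv.
have /cv[N _ H] : nbhs 0%:E [set y | (y < e%:E)%E] by exact: (@nbhs_open_ereal_lt _ 0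
  (fun=> e)).
by exists N; exact: (H N (leqnn N)).
Qed.

Definition sqint (h : R -> R) : \bar R := (\int[mu]_(x in D) ((h x) ^+ 2 * w x)%:E)%E.

Let measurable_sq (h : R -> R) : measurable_fun D h -> measurable_fun D (fun x => h x
  ^+ 2 * w x).
Proof. by move=> mh; apply: measurable_funM => //; exact: measurable_funX. Qed.

(** The factors 2 avoid square roots: 2 a^2 + 2 b^2 - (a + b)^2 = (a - b)^2. *)
Lemma sqint_triangle (f g h : R -> R) :
  measurable_fun D f -> measurable_fun D g -> measurable_fun D h ->
  (sqint (f \- h)%R <= 2%:E * sqint (f \- g)%R + 2%:E * sqint (g \- h)%R)%E.
Proof.
move=> mf mg mh.
have mfg := measurable_sq (measurable_funB mf mg).
have mgh := measurable_sq (measurable_funB mg mh).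
have P k x : D x -> (0 <= (k x ^+ 2 * w x)%:E)%E.
  by move=> Dx; rewrite lee_fin mulr_ge0 ?sqr_ge0 ?w0.
rewrite /sqint -!ge0_integralZl_EFin//; do ?[by move=> x;
  exact: P|exact/measurable_EFinP].
rewrite -ge0_integralD//; first last.
- by apply: measurable_funeM; exact/measurable_EFinP.
- by move=> x Dx; rewrite mule_ge0 ?P// lee_fin.
- by apply: measurable_funeM; exact/measurable_EFinP.
- by move=> x Dx; rewrite mule_ge0 ?P// lee_fin.
apply: ge0_le_integral => //.
- by move=> x; exact: P.
- by apply/measurable_EFinP; exact: (measurable_sq (measurable_funB mf mh)).
- by apply: emeasurable_funD; apply: measurable_funeM; exact/measurable_EFinP.
move=> x Dx; rewrite -!EFinM -EFinD lee_fin /= !mulrA -mulrDl ler_wpM2r ?w0//.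
rewrite -subr_ge0 -!mulrA -!expr2.
have -> : 2 * (f x - g x) ^+ 2 + 2 * (g x - h x) ^+ 2 - (f x - h x) ^+ 2 =
  ((f x - g x) - (g x - h x)) ^+ 2 by ring.
exact: sqr_ge0.
Qed.

(** At each point the truncation is eventually g itself, and g^2 w dominates the error. *)
Lemma sqint_truncate (g : R -> R) (e : R) : measurable_fun D g -> (sqint g < +oo)%E
  -> 0 < e ->
  exists2 n : nat, measurable_fun D (fun x => if `|g x| <= n%:R then g x else 0) &
    (sqint (fun x => g x - if `|g x| <= n%:R then g x else 0)%R < e%:E)%E.
Proof.
move=> mg sg e0.
have mt (n : nat) : measurable_fun D (fun x => if `|g x| <= n%:R then g x else 0).
  apply: measurable_fun_if => //.
  - by apply: measurable_fun_ler => //; exact: measurableT_comp.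
  - by apply: measurable_funS mg => // x [].
have [||||//|n Hn] := @dominated_small
    (fun n x => (g x - if `|g x| <= n%:R then g x else 0) ^+ 2 * w x)
    (fun x => g x ^+ 2 * w x) e.
- by move=> n; apply: measurable_sq; exact: measurable_funB.
- move=> n x Dx; rewrite mulr_ge0 ?sqr_ge0 ?w0//= ler_wpM2r ?w0//.
  by case: ifP => _; rewrite ?subrr ?subr0// expr0n sqr_ge0.
- apply/integrableP; split; first by apply/measurable_EFinP; exact: measurable_sq.
  apply: le_lt_trans sg; rewrite le_eqVlt; apply/orP; left; apply/eqP;
    apply: eq_integral => x /set_mem Dx.
  by rewrite gee0_abs// lee_fin mulr_ge0 ?sqr_ge0 ?w0.
- move=> x Dx; apply: cvg_near_cst.
  exists (Num.bound `|g x|) => // n /= gn.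
  rewrite ifT ?subrr ?expr0n ?mul0r// ltW// (lt_le_trans (archi_boundP _))//.
  by rewrite ler_nat.
by exists n.
Qed.

(** The weight may be unbounded; integrability makes the part where it exceeds a large n
    negligible. *)
Lemma weight_tail (e : R) : 0 < e ->
  exists n : nat, (\int[mu]_(x in D) (if w x <= n%:R then 0 else w x)%:E < e%:E)%E.
Proof.
move=> e0; apply: (@dominated_small _ w) => //.
- move=> n; apply: measurable_fun_if => //.
  + exact: measurable_fun_ler.
  + by apply: measurable_funS mw => // x [].
- by move=> n x Dx; case: ifP => _; rewrite ?lexx w0.
- move=> x Dx; apply: cvg_near_cst.
  exists (Num.bound (w x)) => // n /= gn.
  by rewrite ifT// ltW// (lt_le_trans (archi_boundP _)) ?w0// ler_nat.
Qed.

(** The approximation [gk] is taken in unweighted L^1. Where w <= K, (g - h)^2 w <= 2 M K |g - gk|;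
    where w > K, it is at most 4 M^2 w, which [weight_tail] controls. *)
Lemma sqint_continuous (g : R -> R) (M e : R) : 0 <= M -> measurable_fun D g ->
  (forall x, `|g x| <= M) -> 0 < e ->
  exists h : R -> R, [/\ continuous h, forall y, `|h y| <= M & (sqint (g \- h)%R <
    e%:E)%E].
Proof.
move=> M0 mg gM e0.
have b0 : 0 <= 4 * M ^+ 2 by rewrite mulr_ge0 ?sqr_ge0.
(* In this threshold and the next, the + 1 covers a zero constant and yields c (e / 2 / (c + 1)) < e
   / 2 for every c >= 0. *)
have e20 : 0 < e / 2 / (4 * M ^+ 2 + 1) by rewrite !divr_gt0// ltr_wpDl.
have [K HK] := weight_tail e20.
have a0 : 0 <= 2 * M * K%:R by rewrite !mulr_ge0.
have e10 : 0 < e / 2 / (2 * M * K%:R + 1) by rewrite !divr_gt0// ltr_wpDl.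
have finD : (mu D < +oo)%E.
  by rewrite /= lebesgue_measure_itv /=; case: ifP => // _; rewrite -EFinD ltry.
have ig : mu.-integrable D (EFin \o g).
  apply: measurable_bounded_integrable => //.
  by exists M; split; [exact: num_real|move=> y /ltW My z _; exact: le_trans (gM z) My].
have [gk [cgk igk]] := approximation_continuous_integrable (measurable_itv _) finD ig.
have /[swap] /[apply] : nbhs 0%:E [set y | (y < (e / 2 / (2 * M * K%:R + 1))%:E)%E].
  exact: (@nbhs_open_ereal_lt _ 0 (fun=> e / 2 / (2 * M * K%:R + 1))).
case=> k _ /(_ k (leqnn k)) /= Hk.
(* Clipping to [- M, M] bounds the approximation without moving it away from g, whose values lie
   there. *)
pose h y := Num.max (- M) (Num.min M (gk k y)).
have ch : continuous h.
  move=> y; apply: (@continuous_max _ _ (cst (- M)) (cst M \min gk k));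
    first exact: cvg_cst.
  by apply: continuous_min; [exact: cvg_cst|exact: cgk].
have hM y : `|h y| <= M.
  by rewrite ler_norml /h le_max lexx/= ge_max ge_min lexx/= andbT; lra.
have mgk : measurable_fun D (gk k).
  by apply: measurable_funTS; exact: continuous_measurable_fun.
have mh : measurable_fun D h.
  by apply: measurable_funTS; exact: continuous_measurable_fun.
have clip x : `|g x - h x| <= `|g x - gk k x|.
  have := gM x; rewrite ler_norml => /andP[g1 g2].
  rewrite /h; case: (leP M (gk k x)) => G1.
    rewrite max_r; last by lra.
    rewrite ler0_norm ?subr_le0// ler0_norm; last by lra.
    by lra.
  case: (leP (- M) (gk k x)) => G2 //.
  by rewrite ger0_norm ?subr_ge0 1?ger0_norm//; lra.
have gh2 x : `|g x - h x| <= 2 * M.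
  by rewrite (le_trans (ler_normB _ _))// mulr2n mulrDl mul1r lerD.
exists h; split => //.
apply: (@le_lt_trans _ _ ((2 * M * K%:R)%:E * (\int[mu]_(x in D) `|(g x - gk k x)%:E|) +
   (4 * M ^+ 2)%:E * \int[mu]_(x in D) (if w x <= K%:R then 0 else w x)%:E)%E).
  have mI1 : measurable_fun D (fun x => `|(g x - gk k x)%:E|)%E.
    by apply/measurable_EFinP/measurableT_comp => //; exact: measurable_funB.
  have mI2 : measurable_fun D (fun x => (if w x <= K%:R then 0 else w x)%:E)%E.
    apply/measurable_EFinP; apply: measurable_fun_if => //.
    + exact: measurable_fun_ler.
    + by apply: measurable_funS mw => // x [].
  have I2 x : D x -> (0 <= (if w x <= K%:R then 0 else w x)%:E)%E.
    by move=> Dx; rewrite lee_fin; case: ifP => // _; exact: w0.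
  rewrite -!ge0_integralZl_EFin// -ge0_integralD//; first last.
  - by apply: measurable_funeM.
  - by move=> x Dx; apply: mule_ge0; [rewrite lee_fin|exact: I2].
  - by apply: measurable_funeM.
  - by move=> x Dx; rewrite mule_ge0 ?lee_fin.
  apply: ge0_le_integral => //.
  - by move=> x Dx; rewrite lee_fin mulr_ge0 ?sqr_ge0 ?w0.
  - by apply/measurable_EFinP; exact: (measurable_sq (measurable_funB mg mh)).
  - by apply: emeasurable_funD; apply: measurable_funeM.
  move=> x Dx; rewrite -[(_ + _)%E]/((2 * M * K%:R * `|g x - gk k x| +
     4 * M ^+ 2 * (if w x <= K%:R then 0 else w x))%:E) lee_fin.
  rewrite -[(g \- h) x]/(g x - h x) -real_normK ?num_real//.
  have w0x := w0 Dx; have c := clip x; have c2 := gh2 x.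
  have n0 : 0 <= `|g x - h x| by [].
  case: ifPn => wK.
    rewrite mulr0 addr0 -mulrA [K%:R * _]mulrC mulrA ler_pM ?sqr_ge0//.
    by rewrite expr2 ler_pM.
  rewrite -[leLHS]add0r lerD ?mulr_ge0// ler_wpM2r//.
  have -> : 4 * M ^+ 2 = (2 * M) ^+ 2 by ring.
  by rewrite lerXn2r ?nnegrE ?mulr_ge0.
apply: (@le_lt_trans _ _ ((2 * M * K%:R)%:E * (e / 2 / (2 * M * K%:R + 1))%:E +
   (4 * M ^+ 2)%:E * (e / 2 / (4 * M ^+ 2 + 1))%:E)%E).
  by apply: leeD; apply: lee_wpmul2l; rewrite ?lee_fin// ltW.
have aux (c : R) : 0 <= c -> c * (e / 2 / (c + 1)) < e / 2.
  move=> c0; have c1 : 0 < c + 1 by lra.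
  by rewrite mulrCA gtr_pMr ?divr_gt0// ltr_pdivrMr// mul1r ltrDl.
by rewrite -!EFinM -EFinD lte_fin [ltRHS]splitr ltrD// aux.
Qed.

(** Bernstein polynomials carried to [-1, 1] converge pointwise and stay bounded by M, so (2 M)^2 w
    dominates the squared error. *)
Lemma sqint_bernstein (h : R -> R) (M e : R) : continuous h ->
  (forall y, `|h y| <= M) -> 0 < e ->
  exists p : {poly R}, (sqint (fun x => h x - p.[x])%R < e%:E)%E.
Proof.
move=> ch hM e0.
pose B n x := bernstein n.+1 (fun k => h (2 * (k%:R / n.+1%:R) - 1)) ((1 + x) / 2).
have BP n : exists p : {poly R}, forall x, p.[x] = B n x.
  have [q qE] := bernstein_poly n.+1 (fun k => h (2 * (k%:R / n.+1%:R) - 1)).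
  exists (q \Po (2^-1 *: (1 + 'X))) => x.
  by rewrite horner_comp qE /B; congr bernstein; rewrite !hornerE mulrC.
have mB n : measurable_fun D (B n).
  have [p pE] := BP n; rewrite -(_ : horner p = B n); last exact/funext.
  by apply: measurable_funTS; apply: continuous_measurable_fun;
    exact: continuous_horner.
have mh : measurable_fun D h.
  by apply: measurable_funTS; exact: continuous_measurable_fun.
have [||||//|n Hn] := @dominated_small (fun n x => (h x - B n x) ^+ 2 * w x)
  (fun x => (2 * M) ^+ 2 * w x) e.
- by move=> n; exact: (measurable_sq (measurable_funB mh (mB n))).
- move=> n x Dx; rewrite mulr_ge0 ?sqr_ge0 ?w0//= ler_wpM2r ?w0//.
  have M0 : 0 <= M := le_trans (normr_ge0 _) (hM 0).
  rewrite -real_normK ?num_real// lerXn2r ?nnegrE ?mulr_ge0//.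
  rewrite (le_trans (ler_normB _ _))// mulr2n mulrDl mul1r lerD// bernstein_bound//.
  by move: Dx; rewrite /= in_itv /= => /andP[x1 x2]; apply/andP; split; lra.
- rewrite (_ : _ \o _ = (fun x => ((2 * M) ^+ 2)%:E * (EFin \o w) x)%E)//.
  exact: integrableZl.
- move=> x Dx; rewrite -[X in _ --> X](mul0r (w x)); apply: cvgMr_tmp.
  have c : h x - B n x @[n --> \oo] --> (0 : R).
    rewrite -(subrr (h x)); apply: cvgB; first exact: cvg_cst.
    apply: (bernstein_cvg hM); first exact: ch.
    by move: Dx; rewrite /= in_itv.
  by rewrite -[X in _ --> X](mulr0 0); under eq_fun do rewrite expr2; exact: cvgM.
have [p pE] := BP n; exists p.
by apply: le_lt_trans Hn; rewrite le_eqVlt; apply/orP; left;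
  apply/eqP/eq_integral => x _; rewrite pE.
Qed.

Lemma poly_dense (g : R -> R) (e : R) : measurable_fun D g -> (sqint g < +oo)%E -> 0
  < e ->
  exists p : {poly R}, (sqint (fun x => g x - p.[x])%R < e%:E)%E.
Proof.
(* Two triangle inequalities use 2 + 2 (2 + 2) = 10 shares of e / 11. *)
move=> mg sg e0; have e10 : 0 < e / 11 by rewrite divr_gt0.
have [n mt Ht] := sqint_truncate mg sg e10.
set t := fun x => if _ then _ else _ in mt Ht.
have tn x : `|t x| <= n%:R by rewrite /t; case: ifP => //; rewrite normr0.
have [h [ch hM Hh]] := sqint_continuous (ler0n _ n) mt tn e10.
have [p Hp] := sqint_bernstein ch hM e10.
have mh : measurable_fun D h.
  by apply: measurable_funTS; exact: continuous_measurable_fun.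
have mp : measurable_fun D (horner p).
  by apply: measurable_funTS; apply: continuous_measurable_fun;
    exact: continuous_horner.
exists p; apply: le_lt_trans (sqint_triangle mg mt mp) _.
apply: (@le_lt_trans _ _ (2%:E * (e / 11)%:E + 2%:E * (2%:E * (e / 11)%:E + 2%:E * (e
  / 11)%:E))%E).
  apply: leeD; apply: lee_wpmul2l; rewrite ?lee_fin// ?(ltW Ht)//.
  apply: le_trans (sqint_triangle mt mh mp) _.
  by apply: leeD; apply: lee_wpmul2l; rewrite ?lee_fin// ltW.
rewrite -[X in (X < _)%E]/((2 * (e / 11) + 2 * (2 * (e / 11) + 2 * (e / 11)))%:E).
by rewrite lte_fin; lra.
Qed.

End PolynomialDensity.

(** * Fourier expansion *)

Section JacobiExpansion.
Context {R : realType}.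
Variables (al be : R) (g : R -> R).
Hypotheses (al1 : -1 < al) (be1 : -1 < be).
Notation mu := (@lebesgue_measure R).
Notation w := (jacobi_weight al be).
Notation D := (`[(-1)%R, 1%R]%classic : set R).
Hypotheses (mg : measurable_fun D g) (sg : (sqint w g < +oo)%E).
Implicit Types (p q : {poly R}) (n N : nat) (u : nat -> R).

Let mw : measurable_fun D w.
Proof. by apply: measurable_funTS; exact: measurable_jacobi_weight. Qed.

Let w0 x : D x -> 0 <= w x. Proof. by move=> _; exact: jacobi_weight_ge0. Qed.

Let iw : mu.-integrable D (EFin \o w).
Proof.
have := integrable_poly_jacobi al1 be1 1%:P.
by apply: eq_integrable => // x _ /=; rewrite hornerC mul1r.
Qed.

Let mp p : measurable_fun D (horner p).
Proof.
by apply: measurable_funTS; apply: continuous_measurable_fun; exact: continuous_horner.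
Qed.

Let mD : measurable (D : set (measurableTypeR R)). Proof. exact: measurable_itv. Qed.

Let isq : mu.-integrable D (fun x => (g x ^+ 2 * w x)%:E).
Proof.
apply/integrableP; split.
  by apply/measurable_EFinP; apply: measurable_funM => //; exact: measurable_funX.
apply: le_lt_trans sg; rewrite le_eqVlt; apply/orP; left; apply/eqP.
apply: eq_integral => x /set_mem Dx.
by rewrite gee0_abs// lee_fin mulr_ge0 ?sqr_ge0 ?w0.
Qed.

(** |g p| <= g^2 + p^2, and both terms are integrable against w. *)
Lemma integrable_mul_jacobi p : mu.-integrable D (fun x => (g x * p.[x] * w x)%:E).
Proof.
have := integrableD mD isq (integrable_poly_jacobi al1 be1 (p ^+ 2)).
apply: le_integrable => //.
  by apply/measurable_EFinP; exact: (measurable_funM (measurable_funM mg (mp p)) mw).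
move=> x Dx /=; rewrite lee_fin normrM [`|w x|]ger0_norm ?w0//.
rewrite [leRHS]ger0_norm; last by rewrite horner_exp addr_ge0// mulr_ge0 ?sqr_ge0 ?w0.
rewrite -mulrDl ler_wpM2r ?w0// normrM horner_exp.
rewrite -[g x ^+ 2]real_normK ?num_real// -[p.[x] ^+ 2]real_normK ?num_real//.
move: (normr_ge0 (g x)) (normr_ge0 p.[x]); move: `|g x| `|p.[x]| => a b a0 b0.
have : 0 <= (a - b) ^+ 2 by exact: sqr_ge0.
have : 0 <= a * b by exact: mulr_ge0.
by rewrite sqrrB; lra.
Qed.

Definition jinner p : R := \int[mu]_(x in D) (g x * p.[x] * w x).

Lemma jinnerD p q : jinner (p + q) = jinner p + jinner q.
Proof.
rewrite /jinner -RintegralD//; [|exact: integrable_mul_jacobi..].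
by apply: eq_Rintegral => x _; rewrite hornerD mulrDr mulrDl.
Qed.

Lemma jinnerZ a p : jinner (a *: p) = a * jinner p.
Proof.
rewrite /jinner -RintegralZl//; last exact: integrable_mul_jacobi.
by apply: eq_Rintegral => x _; rewrite hornerZ; ring.
Qed.

Lemma jinner0 : jinner 0 = 0.
Proof. by rewrite -(scale0r 0) jinnerZ mul0r. Qed.

Lemma jinner_sum I (r : seq I) (P : pred I) (F : I -> {poly R}) :
  jinner (\sum_(i <- r | P i) F i) = \sum_(i <- r | P i) jinner (F i).
Proof. exact: (big_morph jinner jinnerD jinner0). Qed.

Let G2 : R := \int[mu]_(x in D) (g x ^+ 2 * w x).

Lemma sqint_sub p :
  sqint w (fun x => g x - p.[x]) = (G2 - 2 * jinner p + jint al be (p ^+ 2))%:E.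
Proof.
have i1 := integrable_mul_jacobi (- 2 *: p).
have i2 := integrable_poly_jacobi al1 be1 (p ^+ 2).
have i12 := integrableD mD isq i1.
have i := integrableD mD i12 i2.
have -> : G2 - 2 * jinner p + jint al be (p ^+ 2) =
    \int[mu]_(x in D) (g x ^+ 2 * w x + g x * (- 2 *: p).[x] * w x + (p ^+ 2).[x] * w
      x).
  rewrite RintegralD// RintegralD//; congr (_ + _ + _).
  by rewrite -[RHS]/(jinner _) jinnerZ mulNr.
rewrite /sqint /Rintegral fineK; last exact: integrable_fin_num i.
apply: eq_integral => x _; congr EFin; rewrite hornerZ horner_exp; ring.
Qed.

Definition jcoef n : R := jinner (jacobi al be n) / jacobi_norm2 al be n.

Definition jpartial u N : {poly R} := \sum_(k < N.+1) u k *: jacobi al be k.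

Lemma jint_jpartial_sqr u N :
  jint al be (jpartial u N ^+ 2) = \sum_(k < N.+1) u k ^+ 2 * jacobi_norm2 al be k.
Proof.
rewrite expr2 {2}/jpartial mulr_sumr jint_sum//; apply: eq_bigr => k _.
rewrite -scalerAr jintZ// /jpartial mulr_suml jint_sum// (bigD1 k)//= big1 ?addr0.
  by rewrite -scalerAl jintZ// mulrA.
by move=> i ik; rewrite -scalerAl jintZ// jint_jacobi_neq ?mulr0.
Qed.

(* Squared distance from g to the polynomials of degree at most N. *)
Definition jdefect N : R := G2 - \sum_(k < N.+1) jcoef k ^+ 2 * jacobi_norm2 al be k.

(** By orthogonality the square is completed coordinate by coordinate: u^2 - 2 u c = (u - c)^2 -
    c^2. *)
Lemma sqint_jpartial u N : sqint w (fun x => g x - (jpartial u N).[x]) =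
  (jdefect N + \sum_(k < N.+1) (u k - jcoef k) ^+ 2 * jacobi_norm2 al be k)%:E.
Proof.
rewrite sqint_sub; congr EFin.
rewrite jint_jpartial_sqr {1}/jpartial jinner_sum /jdefect -!addrA; congr (_ + _).
rewrite mulr_sumr -!sumrN -!big_split /=; apply: eq_bigr => k _.
have h0 := jacobi_norm2_gt0 al1 be1 k.
rewrite jinnerZ (_ : jinner _ = jcoef k * jacobi_norm2 al be k); first by ring.
by rewrite /jcoef divfK// gt_eqF.
Qed.

(** Bessel's inequality: for the Fourier coefficients the squared distance is exactly the defect. *)
Lemma jdefect_ge0 N : 0 <= jdefect N.
Proof.
have := sqint_jpartial jcoef N.
rewrite big1 ?addr0 => [H|k _]; last by rewrite subrr expr0n mul0r.
rewrite -lee_fin -H; apply: integral_ge0 => x Dx.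
by rewrite lee_fin mulr_ge0 ?sqr_ge0 ?w0.
Qed.

(** Parseval: a polynomial close to g is a [jpartial] for every N at least its size, and its squared
    distance to g bounds the defect from above. *)
Lemma jdefect_cvg : jdefect N @[N --> \oo] --> (0 : R).
Proof.
apply/cvgrPdist_le => e e0.
have [p Hp] := poly_dense mw w0 iw mg sg e0.
exists (size p) => // N /= pN.
rewrite sub0r normrN ger0_norm ?jdefect_ge0//.
have [v pE] : exists v, p = jpartial v N by apply: jacobi_basis => //; exact: leqW.
move: Hp; rewrite pE sqint_jpartial lte_fin => /ltW; apply: le_trans.
rewrite lerDl sumr_ge0// => k _; rewrite mulr_ge0 ?sqr_ge0// ltW//.
exact: jacobi_norm2_gt0.
Qed.

End JacobiExpansion.

(** * Logarithms of the multiplicative operations *)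

Section Multiplicative.
Context {R : realType}.

Lemma ln_modot (k s : R) : ln (modot k s) = ln s * ln k.
Proof. exact: ln_powR. Qed.

Lemma modot_expR (a b : R) : modot (expR a) (expR b) = expR (a * b).
Proof. by rewrite /modot expRK expRM. Qed.

Lemma minnerE a b (w f g : R -> R) (r : R) :
  (\int[lebesgue_measure]_(x in `[a, b]) (ln (f x) * ln (g x) * w x)%:E = r%:E)%E ->
  minner a b w f g = expR r.
Proof.
move=> E; rewrite /minner /mint (_ : (\int[_]_(x in _) _)%E = r%:E)//.
by rewrite -E; apply: eq_integral => x _; rewrite ln_modot [ln (g x) * _]mulrC.
Qed.
End Multiplicative.


(** * The multiplicative Jacobi-Fourier series *)

Section JacobiFourier.
Context {R : realType}.
Variables (al be : R) (f : R -> R).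
Hypotheses (al1 : -1 < al) (be1 : -1 < be).
Hypothesis hf : mL2 (-1) 1 (jacobi_weight al be) f.
Notation mu := (@lebesgue_measure R).
Notation w := (jacobi_weight al be).
Notation D := (`[(-1)%R, 1%R]%classic : set R).
Notation g := (fun x => ln (f x)).

Let mg : measurable_fun D g.
Proof.
have [mf _ _] := hf.
by apply: (measurableT_comp (@measurable_ln R)).
Qed.

Let sg : (sqint w g < +oo)%E.
Proof.
have [_ _] := hf; rewrite /mint.
rewrite (_ : (\int[_]_(x in _) _)%E = sqint w g);
  first by case: (sqint w g) => [r|//|]; rewrite ?ltry.
by apply: eq_integral => x _; rewrite ln_modot -expr2.
Qed.

Lemma minner_mjacobi n : minner (-1) 1 w f (mjacobi al be n) =
  expR (jinner al be g (jacobi al be n)).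
Proof.
apply: minnerE; rewrite /jinner /Rintegral fineK.
  by apply: eq_integral => x _; rewrite /mjacobi expRK.
exact: integrable_fin_num (integrable_mul_jacobi al1 be1 mg sg _).
Qed.

Lemma minner_mjacobi2 n : minner (-1) 1 w (mjacobi al be n) (mjacobi al be n) =
  expR (jacobi_norm2 al be n).
Proof.
apply: minnerE; rewrite /jacobi_norm2 /jint /Rintegral fineK.
  by apply: eq_integral => x _; rewrite /mjacobi expRK hornerM.
exact: integrable_fin_num (integrable_poly_jacobi al1 be1 _).
Qed.

Lemma mjacobi_coefE n : mjacobi_coef al be f n = jcoef al be g n.
Proof.
rewrite /mjacobi_coef minner_mjacobi /mnorm sqr_sqrtr minner_mjacobi2 ?expR_ge0//.
by rewrite !expRK.
Qed.

Lemma mjacobi_partialE (u : nat -> R) N x :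
  mjacobi_partial al be u N x = expR (jpartial al be u N).[x].
Proof.
rewrite /mjacobi_partial big_mkord horner_sum expR_sum; apply: eq_bigr => k _.
by rewrite /mjacobi modot_expR [in RHS]hornerZ.
Qed.

(** The logarithm of the quotient is ln f minus a partial sum, so [sqint_jpartial] gives the
    exponent. *)
Lemma mnorm_partial (u : nat -> R) N :
  mnorm (-1) 1 w (fun x => f x / mjacobi_partial al be u N x) =
  Num.sqrt (expR (jdefect al be g N +
    \sum_(k < N.+1) (u k - jcoef al be g k) ^+ 2 * jacobi_norm2 al be k)).
Proof.
congr Num.sqrt; apply: minnerE; rewrite -sqint_jpartial//.
apply: eq_integral => x /set_mem Dx; have [_ fpos _] := hf.
by rewrite mjacobi_partialE ln_div ?posrE ?expR_gt0 ?fpos// expRK -expr2.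
Qed.

(** For the Fourier coefficients only the defect remains; it tends to 0, where sqrt (exp x) is
    continuous with value 1. *)
Lemma mjacobi_cvg_coef : mjacobi_cvg al be f (jcoef al be g).
Proof.
rewrite /mjacobi_cvg.
under eq_fun do rewrite mnorm_partial.
have -> : 1 = Num.sqrt (expR 0) :> R by rewrite expR0 sqrtr1.
apply: continuous_cvg; first exact: sqrt_continuous.
apply: continuous_cvg; first exact: continuous_expR.
under eq_fun => N.
  rewrite big1 ?addr0; last by move=> k _; rewrite subrr expr0n mul0r.
  over.
exact: jdefect_cvg.
Qed.

(** A wrong coefficient at n adds a fixed d > 0 to the squared distance for every N >= n, so the
    norms stay at least sqrt (exp d) > 1. *)
Lemma mjacobi_cvg_unique (u : nat -> R) : mjacobi_cvg al be f u -> u =1 jcoef al be g.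
Proof.
move=> cu n; apply/eqP; rewrite -subr_eq0; apply/negPn/negP => un.
have h0 := jacobi_norm2_gt0 al1 be1.
pose d := (u n - jcoef al be g n) ^+ 2 * jacobi_norm2 al be n.
have d0 : 0 < d by rewrite mulr_gt0// exprn_even_gt0.
have s1 : 1 < Num.sqrt (expR d) by rewrite -sqrtr1 ltr_sqrt ?expR_gt1// expR_gt0.
move/cvgrPdist_lt : cu => /(_ (Num.sqrt (expR d) - 1)).
(* The index [maxn N0 n] is late enough for the limit and large enough for the sum to contain the
   term n. *)
rewrite subr_gt0 => /(_ s1)[N0 _ /(_ (maxn N0 n) (leq_maxl _ _))] /=.
rewrite mnorm_partial ltr_norml => /andP[+ _]; apply/negP; rewrite -leNgt.
rewrite opprB lerD2l lerN2 ler_sqrt ?expR_ge0// ler_expR.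
rewrite -[leLHS]add0r lerD ?jdefect_ge0//.
have nN : (n < (maxn N0 n).+1)%N by rewrite ltnS leq_maxr.
rewrite (bigD1 (Ordinal nN))//= -[leLHS]addr0 lerD// sumr_ge0// => k _.
by rewrite mulr_ge0 ?sqr_ge0// ltW.
Qed.

End JacobiFourier.

Theorem theorem5p1 (R : realType) (alpha beta : R) (f : R -> R)
    (halpha : -1 < alpha) (hbeta : -1 < beta)
    (hf : mL2 (-1) 1 (jacobi_weight alpha beta) f) :
  let fc := mjacobi_coef alpha beta f in
  [/\ forall n : nat,
        fc n = jacobi_Gamma_factor alpha beta n / 2 `^ (alpha + beta + 1) *
               (n`!%:R / (Gamma (n%:R + alpha + 1) * Gamma (n%:R + beta + 1))) *
               \int[lebesgue_measure]_(x in `[(-1)%R, 1%R])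
                  (ln (f x) * (jacobi alpha beta n).[x] *
                   jacobi_weight alpha beta x),
      forall (n : nat) (x : R), x \in `[-1, 1] ->
        modot (expR (fc n)) (mjacobi alpha beta n x) =
        expR (fc n * (jacobi alpha beta n).[x]),
      mjacobi_cvg alpha beta f fc &
      forall u : nat -> R, mjacobi_cvg alpha beta f u ->
        forall n : nat, u n = fc n].
Proof.
move=> fc.
have fcE : fc = jcoef alpha beta (fun x => ln (f x)).
  by apply/funext => n; exact: mjacobi_coefE.
split.
- move=> n; rewrite fcE /jcoef jacobi_norm2E// !invfM !invrK.
  by rewrite /jinner; ring.
- by move=> n x _; rewrite modot_expR.
- by rewrite fcE; exact: mjacobi_cvg_coef.
- by move=> u cu n; rewrite fcE; exact: mjacobi_cvg_unique.
Qed.
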